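(* Let $t\ge1$ and let $\mathbf{s}=(s_1,\ldots,s_r)$ be integers greater than $1$ with $\prod_i s_i=4t+2$, such that $s_1/2,s_2,\ldots,s_r$ are odd; let $G=\mathbb{Z}_{s_1}\times\cdots\times\mathbb{Z}_{s_r}$ and let $\mathbf z\in\{0,1\}^r$, $\mathbf z\neq\mathbf 0$. A binary $\mathbf s$-array $\phi:G\to\{\pm1\}$ with $\phi(0)=1$ is a GOBA$(\mathbf s)$ of type $\mathbf z$ if and only if the cocycle $f_{\mathbf z}\,\partial\phi$ is quasi-orthogonal.
   Context: Cyclic groups are written additively. $E=\mathbb{Z}_{(z_1+1)s_1}\times\cdots\times\mathbb{Z}_{(z_r+1)s_r}$, $H=\{h\in E : h_i=0 \text{ if } z_i=0,\ h_i\in\{0,s_i\}\text{ if } z_i=1\}$, $K=\{k\in H: k\text{ has an even number of nonzero coordinates}\}$; $\iota:\{\pm1\}\to E/K$ sends $-1$ to the generator of $H/K$. Identify $x\in G$ with the element of $E$ with coordinates $x_i\in\{0,\ldots,s_i-1\}$, $\tau(x)=x+K$, and $f_{\mathbf z}(x,y)=\iota^{-1}(\tau(x)+\tau(y)-\tau(x+y))$; equivalently $f_{\mathbf z}(x,y)=\prod_{i: z_i=1}(-1)^{\lfloor (x_i+y_i)/s_i\rfloor}$. $\partial\phi(x,y)=\phi(x)\phi(y)\phi(x+y)$. Expansion: for $g\in E$ with reduction $a$ modulo $\mathbf s$, $\phi'(g)=\phi(a)$ if $g\in a+K$ and $-\phi(a)$ otherwise; $R_{\phi'}(g)=\sum_{x\in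 E}\phi'(x)\phi'(x+g)$. $\phi$ is a GOBA$(\mathbf s)$ of type $\mathbf z$ if (i) $R_{\phi'}(g)\in\{0,\pm2|H|\}$ for all $g\in E\setminus H$, and, if $z_1=1$, (ii) $|\{g\in E\mid R_{\phi'}(g)=0\}|=|E|/2$. For a group $G$ of order $4t+2$ and a normalized cocycle $\psi:G\times G\to\{\pm1\}$ (i.e. $\psi(1,1)=1$ and $\psi(g,h)\psi(gh,k)=\psi(g,hk)\psi(h,k)$), the row excess $RE(M_\psi)$ of $M_\psi=[\psi(g,h)]_{g,h\in G}$ is $\sum_{g\ne 1}|\sum_{h\in G}\psi(g,h)|$. A coboundary is a cocycle of the form $\partial\varphi$ with $\varphi(1)=1$. $\psi$ is quasi-orthogonal if either $\psi$ is not a coboundary and $RE(M_\psi)=4t$, or $\psi$ is a coboundary and $RE(M_\psi)=8t+2$. *)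

(* Defs.v *)
From HB Require Import structures.
From mathcomp Require Import all_boot all_order all_algebra all_fingroup.
From mathcomp Require Import zify.

Set Implicit Arguments.
Unset Strict Implicit.
Unset Printing Implicit Defensive.

Import Order.TTheory GRing.Theory Num.Theory.
Local Open Scope ring_scope.

Definition binary (T : Type) (phi : T -> int) : Prop :=
  forall x, phi x = 1 \/ phi x = -1.

Section Cocycles.
Variable gT : finGroupType.
Implicit Types (psi : gT -> gT -> int) (phi : gT -> int).

Definition normalized_cocycle psi : Prop :=
  [/\ forall g, binary (psi g),
      psi 1%g 1%g = 1
    & forall g h k, psi g h * psi (g * h)%g k = psi g (h * k)%g * psi h k].

Definition cobd phi (x y : gT) : int := phi x * phi y * phi (x * y)%g.

Definition coboundary psi : Prop :=
  exists phi, [/\ binary phi, phi 1%g = 1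
                & forall x y, psi x y = cobd phi x y].

Definition row_excess psi : int :=
  \sum_(g : gT | g != 1%g) `| \sum_(h : gT) psi g h |.

Definition quasi_orthogonal (t : nat) psi : Prop :=
  [/\ #|gT| = (4 * t + 2)%N,
      normalized_cocycle psi
    & (~ coboundary psi /\ row_excess psi = (4 * t)%N%:Z) \/
      (coboundary psi /\ row_excess psi = (8 * t + 2)%N%:Z)].

End Cocycles.

(* The direct product of the Z_(m i). The group law, written multiplicatively
   as everywhere in fingroup, is coordinatewise addition (cycprodME below).
   'Z_n is the integers modulo n only for n > 1. *)
Definition cycprod (r : nat) (m : 'I_r -> nat) : finGroupType :=
  {dffun forall i : 'I_r, 'Z_(m i)}.

Section Arrays.
Variables (r : nat) (s : 'I_r.+1 -> nat) (z : 'I_r.+1 -> bool).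

Local Notation G := (cycprod s).

Definition Egrp : finGroupType := cycprod (fun i => ((z i + 1) * s i)%N).

Definition ecoord (g : Egrp) (i : 'I_r.+1) : 'Z_((z i + 1) * s i) := g i.
Definition gcoord (x : G) (i : 'I_r.+1) : 'Z_(s i) := x i.

Definition Hset : {set Egrp} :=
  [set h | [forall i, (~~ z i ==> (ecoord h i == 0)) &&
                      (z i ==> (ecoord h i \in [:: 0; (s i)%:R]))]].

Definition nzcoord (h : Egrp) : nat := #|[set i | ecoord h i != 0]|.

Definition Kset : {set Egrp} := [set k in Hset | ~~ odd (nzcoord k)].

(* The element of E with the same coordinates in {0, ..., s i - 1} as x. *)
Definition liftG (x : G) : Egrp :=
  [ffun i => (inZp (gcoord x i) : 'Z_((z i + 1) * s i))].

Definition redE (g : Egrp) : G := [ffun i => (inZp (ecoord g i) : 'Z_(s i))].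

Definition tau (x : G) : coset_of Kset := coset Kset (liftG x).

(* For z <> 0, H / K has order 2, so (H / K)^# is the singleton of its
   generator. *)
Definition iotaK (e : int) : coset_of Kset :=
  if e == 1 then 1%g else repr (Hset / Kset)^#%g.

(* The inverse of iotaK on its image H / K. *)
Definition iotaK_inv (c : coset_of Kset) : int :=
  if c == iotaK (-1) then -1 else 1.

Definition fz (x y : G) : int :=
  iotaK_inv (tau x * tau y * (tau (x * y))^-1)%g.

Definition expansion (phi : G -> int) (g : Egrp) : int :=
  if g \in (liftG (redE g) *: Kset)%g then phi (redE g) else - phi (redE g).

Definition autocorr (f : Egrp -> int) (g : Egrp) : int :=
  \sum_(x : Egrp) f x * f (x * g)%g.

Definition is_GOBA (phi : G -> int) : Prop :=
  let R := autocorr (expansion phi) in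
  (forall g, g \notin Hset ->
     [\/ R g = 0, R g = (2 * #|Hset|)%N%:Z | R g = - (2 * #|Hset|)%N%:Z])
  /\ (z ord0 -> (2 * #|[set g : Egrp | R g == 0%R]| = #|Egrp|)%N).

End Arrays.

Lemma cycprodME (r : nat) (m : 'I_r -> nat) (x y : cycprod m) (i : 'I_r) :
  (x * y)%g i = x i + y i.
Proof. by rewrite ffunE. Qed.

Lemma cycprod1E (r : nat) (m : 'I_r -> nat) (i : 'I_r) :
  (1%g : cycprod m) i = 0.
Proof. by rewrite ffunE. Qed.

Lemma cycprodVE (r : nat) (m : 'I_r -> nat) (x : cycprod m) (i : 'I_r) :
  (x^-1)%g i = - x i.
Proof. by rewrite ffunE. Qed.

Section ArraysTheory.
Variables (r : nat) (s : 'I_r.+1 -> nat) (z : 'I_r.+1 -> bool).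
Local Notation E := (Egrp s z).
Local Notation H := (Hset s z).
Local Notation K := (Kset s z).

Lemma ecoordM (g h : E) i : ecoord (g * h)%g i = ecoord g i + ecoord h i.
Proof. exact: cycprodME. Qed.
Lemma ecoord1 i : ecoord (1%g : E) i = 0.
Proof. exact: cycprod1E. Qed.

Lemma natr_sDs i : z i -> (s i)%:R + (s i)%:R = 0 :> 'Z_((z i + 1) * s i).
Proof.
move=> zi; rewrite -natrD.
case: (posnP (s i)) => [->|si]; first by [].
have H2 : (1 < (z i + 1) * s i)%N by rewrite zi; lia.
have -> : (s i + s i = (z i + 1) * s i)%N by rewrite zi; lia.
by apply/val_inj; rewrite /= val_Zp_nat // modnn.
Qed.

Lemma HsetP (h : E) :
  reflect (forall i, ecoord h i = 0 \/ (z i /\ ecoord h i = (s i)%:R)) (h \in H).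
Proof.
rewrite inE; apply: (iffP forallP) => A i; have := A i.
  move=> /andP[/implyP a /implyP b].
  have /orP[zi|zi] : z i || ~~ z i by rewrite orbN.
    by have := b zi; rewrite !inE => /orP[] /eqP ->; [left|right].
  by left; apply/eqP/a.
case=> [->|[zi ->]]; rewrite !inE eqxx ?implybT //.
by rewrite orbT implybT andbT; apply/implyP => /negP.
Qed.

Lemma nzcoordM (g h : E) i : g \in H -> h \in H ->
  (ecoord (g * h)%g i != 0) = (ecoord g i != 0) (+) (ecoord h i != 0).
Proof.
move=> /HsetP-/(_ i) Hg /HsetP-/(_ i) Hh; rewrite ecoordM.
case: Hg => [->|[zi eg]]; first by rewrite add0r eqxx.
case: Hh => [->|[_ eh]]; first by rewrite addr0 eqxx addbF.
by rewrite eg eh natr_sDs // eqxx addbb.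
Qed.

Lemma odd_nzcoord (h : E) : odd (nzcoord h) = \big[addb/false]_i (ecoord h i != 0).
Proof.
rewrite /nzcoord cardsE -sum1_card big_mkcond /=.
rewrite (big_morph odd oddD (erefl _)); apply: eq_bigr => i _.
by rewrite unfold_in; case: (_ == _).
Qed.

Lemma odd_nzcoordM (g h : E) : g \in H -> h \in H ->
  odd (nzcoord (g * h)%g) = odd (nzcoord g) (+) odd (nzcoord h).
Proof.
by move=> Hg Hh; rewrite !odd_nzcoord -big_split /=; apply: eq_bigr => i _; rewrite nzcoordM.
Qed.

Lemma Hset_group_set : group_set H.
Proof.
apply/group_setP; split.
  by apply/HsetP => i; left; rewrite ecoord1.
move=> g h Hg Hh; apply/HsetP => i; rewrite ecoordM.
case: (HsetP _ Hg i) => [->|[zi ->]]; case: (HsetP _ Hh i) => [->|[zi' ->]].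
- by left; rewrite addr0.
- by right; rewrite add0r.
- by right; rewrite addr0.
- by left; rewrite natr_sDs.
Qed.
Canonical Hset_group := Group Hset_group_set.

Lemma Kset_group_set : group_set K.
Proof.
apply/group_setP; split.
  apply/setIdP; split; first exact: group1.
  rewrite odd_nzcoord big1 // => i _; by rewrite ecoord1 eqxx.
move=> g h /setIdP[Hg og] /setIdP[Hh oh]; apply/setIdP; split.
  exact: groupM.
by rewrite odd_nzcoordM // (negPf og) (negPf oh).
Qed.
Canonical Kset_group := Group Kset_group_set.

Lemma E_abel (g h : E) : (g * h = h * g)%g.
Proof. by apply/ffunP => i; rewrite !cycprodME addrC. Qed.
Lemma normK (g : E) : g \in 'N(K)%g.
Proof.
by apply/normP; apply/setP => x; rewrite mem_conjg conjgE invgK (E_abel x) mulgA mulgV mul1g.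
Qed.

Lemma cosetK_eq1 (g : E) : (coset K g == 1%g) = (g \in K).
Proof. apply/eqP/idP => [|/coset_id //]. exact/coset_idr/normK. Qed.

Lemma cosetK_odd (g h : E) : g \in H -> h \in H -> g \notin K -> h \notin K ->
  coset K g = coset K h.
Proof.
move=> Hg Hh Kg Kh; apply/eqP; rewrite eq_mulgV1 -morphV ?normK // -morphM ?normK //.
have HhV : h^-1%g \in H by rewrite groupV.
rewrite cosetK_eq1; apply/setIdP; split; first exact: groupM.
rewrite odd_nzcoordM //.
have oh : odd (nzcoord h^-1%g) = odd (nzcoord h).
  have := odd_nzcoordM HhV Hh; rewrite mulVg odd_nzcoord big1 => [|i _]; last by rewrite ecoord1 eqxx.
  by case: odd; case: odd.
move: Kg Kh; rewrite oh [g \in K]inE [h \in K]inE Hg Hh /= !negbK.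
by move=> -> ->.
Qed.

Lemma iotaN1 (h : E) : h \in H -> h \notin K -> iotaK s z (-1) = coset K h.
Proof.
move=> Hh Kh; rewrite /iotaK /=.
have : repr (H / K)^#%g \in (H / K)^#%g.
  apply: (@mem_repr _ _ (coset K h)); rewrite !inE cosetK_eq1 Kh /=.
  exact: mem_quotient.
case/setD1P => ne /morphimP[y Ny Hy e]; rewrite e; apply: cosetK_odd => //.
by rewrite -cosetK_eq1 -e.
Qed.

Lemma natr_s_neq0 i : z i -> (1 < s i)%N -> (s i)%:R != 0 :> 'Z_((z i + 1) * s i).
Proof.
move=> zi si; apply/eqP => /(congr1 val) /=.
rewrite val_Zp_nat; last by rewrite zi; lia.
by rewrite modn_small ?zi; lia.
Qed.

Lemma iotaK_invE (h : E) : (exists i, z i) -> (forall i, (1 < s i)%N) -> h \in H ->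
  iotaK_inv (coset K h) = (-1) ^+ nzcoord h.
Proof.
move=> [i0 zi0] hs Hh; rewrite /iotaK_inv -signr_odd.
have Ko : (h \in K) = ~~ odd (nzcoord h) by rewrite [LHS]inE Hh.
case: ifPn => [/eqP e|]; last first.
  case: (boolP (h \in K)) => Kh; first by rewrite Ko in Kh; rewrite (negPf Kh).
  by rewrite (iotaN1 Hh Kh) eqxx.
case: (boolP (h \in K)) => Kh; last by move: Kh; rewrite Ko negbK => ->.
pose u : E := [ffun i => if i == i0 then ((s i)%:R : 'Z_((z i + 1) * s i)) else 0].
have uE i : ecoord u i = if i == i0 then ((s i)%:R : 'Z_((z i + 1) * s i)) else 0.
  by rewrite /ecoord ffunE.
have Hu : u \in H.
  apply/HsetP => i; rewrite uE; case: eqP => [->|_]; by [right|left].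
have Ku : u \notin K.
  rewrite [X in ~~ X]inE Hu /= negbK odd_nzcoord (bigD1 i0) //= big1 => [|i ii0].
    rewrite uE eqxx addbF; exact: natr_s_neq0.
  by rewrite uE (negPf ii0) eqxx.
by move: e; rewrite (iotaN1 Hu Ku) (coset_id Kh) => /esym/eqP; rewrite cosetK_eq1 (negPf Ku).
Qed.

Lemma fzE (x y : cycprod s) : (exists i, z i) -> (forall i, (1 < s i)%N) ->
  fz z x y = \prod_(i < r.+1 | z i) (-1) ^+ ((gcoord x i + gcoord y i) %/ s i)%N.
Proof.
move=> hz hs.
rewrite /fz /tau -morphV ?normK // -!morphM ?normK //.
set c := (_ * _)%g.
have ce i : ecoord c i = (z i * ((gcoord x i + gcoord y i) %/ s i) * s i)%:R.
  have hm : (1 < (z i + 1) * s i)%N by have := hs i; case: (z i); lia.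
  rewrite /c ecoordM ecoordM; rewrite {3}/ecoord cycprodVE.
  have L (w : cycprod s) : ecoord (liftG z w) i = (gcoord w i)%:R.
    by rewrite /ecoord ffunE Zp_nat.
  rewrite -/(ecoord (liftG z (x * y)%g) i) !L -natrD.
  apply/eqP; rewrite subr_eq -natrD; apply/eqP.
  have -> : (gcoord (x * y)%g i : nat) = ((gcoord x i + gcoord y i) %% s i)%N.
    by rewrite /gcoord cycprodME /=; congr (_ %% _)%N; exact: Zp_cast.
  set a := (gcoord x i + gcoord y i)%N.
  have ax : (gcoord x i < s i)%N by exact: (leq_trans (ltn_ord _) (eq_leq (Zp_cast (hs i)))).
  have ay : (gcoord y i < s i)%N by exact: (leq_trans (ltn_ord _) (eq_leq (Zp_cast (hs i)))).
  have /orP[zi|zi] : z i || ~~ z i by rewrite orbN.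
    have -> : (z i * (a %/ s i) * s i = a %/ s i * s i)%N by rewrite zi mul1n.
    by rewrite -divn_eq.
  apply/val_inj; rewrite /= !val_Zp_nat //.
  by rewrite (negPf zi) !mul0n !add0n !mul1n modn_mod.
have lt2 i : ((gcoord x i + gcoord y i) %/ s i < 2)%N.
  have ax : (gcoord x i < s i)%N by exact: (leq_trans (ltn_ord _) (eq_leq (Zp_cast (hs i)))).
  have ay : (gcoord y i < s i)%N by exact: (leq_trans (ltn_ord _) (eq_leq (Zp_cast (hs i)))).
  by rewrite ltn_divLR //; have := hs i; lia.
have Hc : c \in H.
  apply/HsetP => i; rewrite ce; move: (lt2 i).
  case: (_ %/ _)%N => [|[|//]] _; first by left; rewrite muln0 mul0n.
  have /orP[zi|zi] : z i || ~~ z i by rewrite orbN.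
    have -> : (z i * 1 * s i = s i)%N by rewrite zi !mul1n.
    by right.
  have -> : (z i * 1 * s i = 0)%N by rewrite (negPf zi).
  by left.
rewrite iotaK_invE // -signr_odd odd_nzcoord.
rewrite [RHS]big_mkcond /=.
rewrite (big_morph (fun b : bool => (-1) ^+ b : int) (@signr_addb _) (erefl _)).
apply: eq_bigr => i _; rewrite ce; move: (lt2 i).
have /orP[zi|zi] : z i || ~~ z i by rewrite orbN.
  rewrite [in RHS]zi.
  case: (_ %/ _)%N => [|[|//]] _; first by rewrite muln0 mul0n eqxx.
  have -> : (z i * 1 * s i = s i)%N by rewrite zi !mul1n.
  by rewrite natr_s_neq0.
set q := (_ %/ _)%N => _; rewrite [in RHS](negPf zi).
have -> : (z i * q * s i = 0)%N by rewrite (negPf zi).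
by rewrite eqxx.
Qed.
End ArraysTheory.

(* Main.v *)
(** Every element of E is uniquely [lift x * h] with [x] in G and [h] in H, and
    translating by [h] multiplies the expansion by the character of H with
    kernel K.  Hence the autocorrelation at [g], with reduction [a], is
    [+- |H|] times the sum [S(a)] of row [a] of [psi = f_z * cobd phi], and the
    GOBA conditions only concern the numbers [S(a)].

    As |G| = 4t + 2, [S(a)] is congruent to 2 modulo 4 exactly when the product
    of row [a] is 1; the cocycle identity makes this product a homomorphism
    [chi : G -> {+-1}].  So the row excess is at least
    [2 (#|chi = 1| - 1)], with equality iff [S(a)] is [+-2] when [chi a = 1] and
    [0] otherwise, for all [a <> 1].  If z_1 = 0 then [psi] is a coboundary and
    [chi] is trivial, so the bound is 8t + 2.  If z_1 = 1, the involution [c] of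
    G has [psi c c = -1]; then [psi] is not a coboundary, row [c] sums to 0,
    hence [chi c = -1] and the bound is 4t. *)

Require Import Defs.
From mathcomp Require Import all_boot all_order all_algebra all_fingroup.
From mathcomp Require Import zify ring.

Set Implicit Arguments.
Unset Strict Implicit.
Unset Printing Implicit Defensive.

Import Order.TTheory GRing.Theory Num.Theory.

Local Open Scope ring_scope.

(** * Sums and products of signs *)

Lemma binaryM (T : Type) (f g : T -> int) :
  binary f -> binary g -> binary (fun x => f x * g x).
Proof. by move=> bf bg x; case: (bf x) => ->; case: (bg x) => ->; [left|right|right|left]. Qed.

Lemma binary_sqr (T : Type) (f : T -> int) x : binary f -> f x * f x = 1.
Proof. by move=> bf; case: (bf x) => ->. Qed.

Lemma binary_sign (T : Type) (n : T -> nat) : binary (fun x => (-1) ^+ n x).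
Proof. by move=> x; rewrite -signr_odd; case: odd; [right|left]. Qed.

(** The witness [N] is the number of values -1; it ties the sum modulo 4 to the sign of the
    product. *)
Lemma sum_prod_binary (T : finType) (f : T -> int) : binary f ->
  exists N : nat, \sum_x f x = #|T|%:Z - (2 * N)%N%:Z /\ \prod_x f x = (-1) ^+ N.
Proof.
move=> bf; exists (\sum_x (f x == (-1)%R))%N; split.
  rewrite -sum1_card big_distrr /= !(big_morph Posz PoszD (erefl _)) -sumrB.
  by apply: eq_bigr => x _; case: (bf x) => ->.
rewrite expr_sum; apply: eq_bigr => x _.
by case: (bf x) => ->.
Qed.

Lemma prod_binary (T I : finType) (f : T -> I -> int) :
  (forall t, binary (f t)) -> binary (fun t => \prod_i f t i).
Proof.
by move=> bf t; have [N [_ ->]] := sum_prod_binary (bf t); exact: (binary_sign (fun=> N) tt).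
Qed.

(** Product 1 makes the number of values -1 even, so the sum is 2 modulo 4 and cannot vanish. *)
Lemma prod1_abs_sum_ge2 (T : finType) (t : nat) (f : T -> int) :
  #|T| = (4 * t + 2)%N -> binary f -> \prod_x f x = 1 -> 2 <= `|\sum_x f x|.
Proof.
move=> cT bf; have [N [-> ->]] := sum_prod_binary bf.
rewrite cT -signr_odd; case: (boolP (odd N)) => //= oN _.
by have := even_halfK oN; rewrite -muln2; lia.
Qed.

Lemma sum0_prodN1 (T : finType) (t : nat) (f : T -> int) :
  #|T| = (4 * t + 2)%N -> binary f -> \sum_x f x = 0 -> \prod_x f x = -1.
Proof.
move=> cT bf S0; case: (prod_binary (fun _ : unit => bf) tt) => // P1.
by have := prod1_abs_sum_ge2 cT bf P1; rewrite S0.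
Qed.

(** * Row sums of cocycles *)

Section RowSums.
Variables (gT : finGroupType) (t : nat) (psi : gT -> gT -> int).
Hypotheses (cG : #|gT| = (4 * t + 2)%N) (cpsi : normalized_cocycle psi).

Let psi_binary g : binary (psi g). Proof. by case: cpsi. Qed.

Definition row_sum g := \sum_h psi g h.
Definition row_prod g := \prod_h psi g h.

Lemma cocycle1g g : psi 1%g g = 1.
Proof.
case: cpsi => _ p11 /(_ 1%g 1%g g); rewrite !mul1g p11 mul1r => e.
by rewrite e binary_sqr.
Qed.

Lemma row_sum1 : row_sum 1%g = (4 * t + 2)%N%:Z.
Proof.
rewrite -cG -sum1_card (big_morph Posz PoszD (erefl _)).
by apply: eq_bigr => h _; rewrite cocycle1g.
Qed.

Lemma row_prod1 : row_prod 1%g = 1.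
Proof. by apply: big1 => h _; rewrite cocycle1g. Qed.

(** Multiply the cocycle identity over its third argument: the constant factor [psi g h] occurs 4t +
    2 times, an even number, and cancels. *)
Lemma row_prodM g h : row_prod (g * h)%g = row_prod g * row_prod h.
Proof.
case: (cpsi) => _ _ coc.
rewrite /row_prod [X in X * _](reindex_inj (mulgI h)) -big_split /=.
under [RHS]eq_bigr => k _ do rewrite -coc.
rewrite big_split /= prodr_const cG.
have -> : (4 * t + 2 = 2 * (2 * t).+1)%N by lia.
by rewrite exprM expr2 binary_sqr // expr1n mul1r.
Qed.

Lemma row_sum_abs_lower g : 2 * (row_prod g == 1)%:Z <= `|row_sum g|.
Proof.
case: eqP => // p1; exact: (prod1_abs_sum_ge2 cG (psi_binary g) p1).
Qed.

(** Condition (i) of a GOBA, transported to the row sums and divided by [#|H|]. *)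
Definition row_values :=
  forall g, g != 1%g -> [\/ row_sum g = 0, row_sum g = 2 | row_sum g = -2].

Lemma row_values_abs g : row_values -> g != 1%g ->
  `|row_sum g| = 2 * (row_sum g != 0)%:Z.
Proof. by move=> rv /rv[] ->. Qed.

(** Summing [row_sum_abs_lower] over [g != 1] bounds the row excess; the -2 removes the identity,
    which has row product 1. The differences are nonnegative, so equality of the sums is equality
    term by term. *)
Lemma row_excess_eq_lower_bound :
  row_excess psi = (2 * #|[set g | row_prod g == 1]|)%N%:Z - 2 <->
  forall g, g != 1%g -> `|row_sum g| = 2 * (row_prod g == 1)%:Z.
Proof.
have cP : (2 * #|[set g | row_prod g == 1]|)%N%:Z - 2
          = \sum_(g | g != 1%g) 2 * (row_prod g == 1)%:Z.
  rewrite -sum1dep_card big_mkcond /= (bigD1 1%g) //= row_prod1 eqxx.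
  rewrite mulnDr PoszD addrAC subrr add0r big_distrr /= (big_morph Posz PoszD (erefl _)).
  by apply: eq_bigr => g _; case: (_ == _).
rewrite cP -[row_excess psi]/(\sum_(g | g != 1%g) `|row_sum g|).
split=> [e g g1|e]; last by apply: eq_bigr => g /e.
have ge0 h : h != 1%g -> 0 <= `|row_sum h| - 2 * (row_prod h == 1)%:Z.
  by rewrite subr_ge0 row_sum_abs_lower.
have /eqP : \sum_(g | g != 1%g) (`|row_sum g| - 2 * (row_prod g == 1)%:Z) = 0.
  by rewrite sumrB e subrr.
by rewrite psumr_eq0 // => /allP /(_ g (mem_index_enum _)); rewrite g1 /= subr_eq0 => /eqP.
Qed.

(** The row product is phi(g) to the power 4t + 2 times the square of the product of all values of
    [phi]. *)
Lemma coboundary_row_prod g : coboundary psi -> row_prod g = 1.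
Proof.
case=> phi [bphi _ e]; rewrite /row_prod; under eq_bigr => h _ do rewrite e /cobd.
have sh : \prod_h phi (g * h)%g = \prod_h phi h by rewrite [RHS](reindex_inj (mulgI g)).
rewrite !big_split /= prodr_const cG sh -mulrA.
have -> : (4 * t + 2 = 2 * (2 * t).+1)%N by lia.
rewrite exprM expr2 binary_sqr // expr1n mul1r.
by rewrite (binary_sqr tt (prod_binary (fun _ : unit => bphi))).
Qed.

Lemma coboundary_quasi_orthogonal :
  coboundary psi -> quasi_orthogonal t psi <-> row_values.
Proof.
move=> cob; have rp g := coboundary_row_prod g cob.
have cR : (2 * #|[set g | row_prod g == 1]|)%N%:Z - 2 = (8 * t + 2)%N%:Z.
  have -> : [set g | row_prod g == 1] = [set: gT] by apply/setP => g; rewrite !inE rp eqxx.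
  by rewrite cardsT cG; lia.
have ex := row_excess_eq_lower_bound; rewrite cR in ex.
split=> [[_ _ [[]//|[_ /ex e]]] g g1 | rv].
  (* Each absolute value is exactly 2 here, so the value 0 allowed by [row_values] does not
     occur. *)
  by have := e g g1; rewrite rp eqxx; case: (ltrP (row_sum g) 0) => ? ?;
    [constructor 3|constructor 2]; lia.
split=> //; right; split=> //; apply/ex => g g1.
have := row_sum_abs_lower g; rewrite row_values_abs // rp eqxx.
by case: eqP.
Qed.

(** * Cocycles with value -1 at an involution *)

Section Involution.
Variable c : gT.
Hypotheses (cc1 : (c * c)%g = 1%g) (psicc : psi c c = -1).

Lemma involution_not_coboundary : ~ coboundary psi.
Proof.
by case=> phi [bphi phi1 e]; have := psicc; rewrite e /cobd cc1 phi1 mulr1 binary_sqr.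
Qed.

(** The cocycle identity at (c, c, h) gives psi(c, ch) = -psi(c, h), so the sum of row [c] is its
    own negative. *)
Lemma row_prod_involution : row_prod c = -1.
Proof.
apply: (sum0_prodN1 cG) => //.
have : row_sum c = - row_sum c.
  rewrite -sumrN [LHS](reindex_inj (mulgI c)); apply: eq_bigr => h _ /=.
  case: cpsi => _ _ /(_ c c h); rewrite cc1 psicc cocycle1g mulr1 => e.
  by rewrite -mulN1r e -mulrA binary_sqr ?mulr1.
by rewrite /row_sum; lia.
Qed.

(** Since [c] has row product -1, translation by [c] exchanges the kernel of [row_prod] with its
    complement. *)
Lemma card_row_prod_eq1 : #|[set g | row_prod g == 1]| = (2 * t + 1)%N.
Proof.
set P := [set g | _].
have : #|P| = #|~: P|.
  rewrite -(card_imset (mem P) (mulIg c)); apply: eq_card => g.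
  have -> : g = (g * c * c)%g by rewrite -mulgA cc1 mulg1.
  rewrite (mem_imset _ _ (mulIg c)) !inE !row_prodM row_prod_involution.
  by case: (prod_binary psi_binary g : _ = 1 \/ _ = -1); rewrite -/(row_prod g) => ->.
by have := cardsC P; rewrite cG; lia.
Qed.

Lemma involution_quasi_orthogonal :
  quasi_orthogonal t psi <->
  row_values /\ (2 * #|[set g | row_sum g == 0%R]| = 4 * t + 2)%N.
Proof.
have ncob := involution_not_coboundary.
have ex := row_excess_eq_lower_bound; rewrite card_row_prod_eq1 in ex.
have R4 : (2 * (2 * t + 1))%N%:Z - 2 = (4 * t)%N%:Z by lia.
rewrite R4 in ex.
split=> [[_ _ [[_ /ex e]|[]//]]|[rv c0]].
  split=> [g g1|].
    have := e g g1; case: (_ == _) => /= ?; last by constructor 1; lia.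
    by case: (ltrP (row_sum g) 0) => ?; [constructor 3|constructor 2]; lia.
  (* This includes [g = 1], where the row sum is 4t + 2 and the row product is 1. *)
  have -> : [set g | row_sum g == 0] = ~: [set g | row_prod g == 1].
    apply/setP => g; rewrite !inE; have [->|/e] := eqVneq g 1%g.
      by rewrite row_sum1 row_prod1 eqxx addnC.
    by case: (_ == 1) => /= ?; lia.
  by have := cardsC [set g | row_prod g == 1]; rewrite cG card_row_prod_eq1; lia.
split=> //; left; split=> //.
rewrite -[row_excess psi]/(\sum_(g | g != 1%g) `|row_sum g|).
under eq_bigr => g g1 do rewrite row_values_abs //.
(* Conversely 2t + 1 rows have nonzero sum. One is the identity row; the other 2t contribute 2 each,
   giving 4t. *)
have := cardsC [set g | row_sum g == 0]; rewrite cG.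
have -> : #|~: [set g | row_sum g == 0]| = (1 + \sum_(g | g != 1%g) (row_sum g != 0%R))%N.
  rewrite -sum1_card big_mkcond /= (bigD1 1%g) //= !inE row_sum1 addn2 /=.
  by congr addn; apply: eq_bigr => g _; rewrite !inE; case: (_ == _).
rewrite -mulr_sumr -(big_morph Posz PoszD (erefl _)).
by move: c0; lia.
Qed.

End Involution.
End RowSums.

(** * Expansions and autocorrelations *)

Section Expansion.
Variables (r : nat) (s : 'I_r.+1 -> nat) (z : 'I_r.+1 -> bool).
Hypotheses (hs : forall i, (1 < s i)%N) (hz : exists i, z i).

Local Notation G := (cycprod s).
Local Notation E := (Egrp s z).
Local Notation H := (Hset s z).
Local Notation K := (Kset s z).
Local Notation lift := (@liftG r s z).
Local Notation f := (@fz r s z).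
Local Notation red := (@redE r s z).

Let modulus_gt1 i : (1 < (z i + 1) * s i)%N.
Proof. by have := hs i; case: (z i); lia. Qed.

Lemma ecoord_lt (g : E) i : (ecoord g i < (z i + 1) * s i)%N.
Proof. by rewrite -[X in (_ < X)%N]Zp_cast. Qed.

Lemma gcoord_lt (x : G) i : (gcoord x i < s i)%N.
Proof. by rewrite -[X in (_ < X)%N]Zp_cast. Qed.

Lemma gcoord1 i : gcoord (1%g : G) i = 0%N :> nat.
Proof. by rewrite /gcoord cycprod1E. Qed.

Lemma gcoordM (x y : G) i :
  gcoord (x * y)%g i = ((gcoord x i + gcoord y i) %% s i)%N :> nat.
Proof. by rewrite /gcoord cycprodME /=; congr (_ %% _)%N; exact: Zp_cast. Qed.

Lemma val_ecoordM (g h : E) i :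
  ecoord (g * h)%g i = ((ecoord g i + ecoord h i) %% ((z i + 1) * s i))%N :> nat.
Proof. by rewrite ecoordM /=; congr (_ %% _)%N; exact: Zp_cast. Qed.

Lemma gcoord_red (g : E) i : gcoord (red g) i = (ecoord g i %% s i)%N :> nat.
Proof. by rewrite /gcoord ffunE /=; congr (_ %% _)%N; exact: Zp_cast. Qed.

Lemma ecoord_lift (x : G) i : ecoord (lift x) i = gcoord x i :> nat.
Proof.
rewrite /ecoord ffunE /= modn_small // [X in (_ < X)%N]Zp_cast //.
by apply: leq_trans (gcoord_lt x i) _; rewrite leq_pmull // addn1.
Qed.

Lemma gcoord_inj (x y : G) : (forall i, gcoord x i = gcoord y i :> nat) -> x = y.
Proof. by move=> e; apply/ffunP => i; apply/val_inj/e. Qed.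

Lemma redM : {morph red : g h / (g * h)%g}.
Proof.
move=> g h; apply: gcoord_inj => i.
by rewrite gcoordM !gcoord_red val_ecoordM modn_dvdm ?dvdn_mull // modnDm.
Qed.

Lemma red_lift x : red (lift x) = x.
Proof.
by apply: gcoord_inj => i; rewrite gcoord_red ecoord_lift modn_small ?gcoord_lt.
Qed.

Lemma red1 : red 1%g = 1%g.
Proof. by apply: (mulgI (red 1%g)); rewrite -redM !mulg1. Qed.

Lemma redV g : red (g^-1)%g = ((red g)^-1)%g.
Proof. by apply/eqP; rewrite eq_sym eq_invg_mul -redM mulgV red1. Qed.

(** The multiples of [s i] below [(z i + 1) * s i] are 0 and, only when [z i] holds, [s i]. *)
Lemma mem_Hset g : (g \in H) = (red g == 1%g).
Proof.
apply/HsetP/eqP => [gH|/(congr1 (fun x => gcoord x)) g1 i].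
  apply: gcoord_inj => i; rewrite gcoord_red gcoord1.
  case: (gH i) => [->|[zi ->]]; first exact: mod0n.
  by rewrite val_Zp_nat // modn_dvdm ?dvdn_mull // modnn.
have : (s i %| ecoord g i)%N.
  by rewrite /dvdn -gcoord_red g1 gcoord1.
case/dvdnP => q eq; have := ecoord_lt g i; rewrite eq ltn_pmul2r; last exact: ltnW.
case: q eq => [|q] eq; first by left; apply: val_inj; rewrite /= eq.
move=> lt; have [zi q0] : z i /\ q = 0%N by move: lt; case: (z i) => lt; split; lia.
right; split=> //; apply: val_inj; rewrite /= val_Zp_nat // eq q0 mul1n modn_small //.
by rewrite zi; have := hs i; lia.
Qed.

(** On [H] this is the character with kernel [K]; outside [H] its value has no such meaning. *)
Definition Hsign (h : E) : int := (-1) ^+ nzcoord h.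

Lemma HsignM : {in H &, {morph Hsign : g h / (g * h)%g >-> g * h}}.
Proof.
move=> g h gH hH; rewrite /Hsign -signr_odd odd_nzcoordM // signr_addb.
by rewrite !signr_odd.
Qed.

Lemma Hsign_sqr h : Hsign h * Hsign h = 1.
Proof. exact: (binary_sqr h (binary_sign (@nzcoord r s z))). Qed.

(** The component of [g] in [H] relative to the section [lift] of the reduction. *)
Definition remainder (g : E) : E := ((lift (red g))^-1 * g)%g.

Lemma remainder_in g : remainder g \in H.
Proof. by rewrite mem_Hset redM redV red_lift mulVg. Qed.

Lemma expansionE (phi : G -> int) g :
  expansion phi g = Hsign (remainder g) * phi (red g).
Proof.
have := remainder_in g; rewrite /expansion mem_lcoset -/(remainder g) => rH.
rewrite [_ \in K]inE rH /= /Hsign -signr_odd.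
by case: odd; rewrite ?mulN1r ?mul1r.
Qed.

Lemma red_mulH g h : h \in H -> red (g * h)%g = red g.
Proof. by rewrite mem_Hset redM => /eqP ->; rewrite mulg1. Qed.

Lemma expansionMH (phi : G -> int) (g h : E) : h \in H ->
  expansion phi (g * h)%g = Hsign h * expansion phi g.
Proof.
move=> hH; rewrite !expansionE red_mulH // /remainder red_mulH // mulgA.
by rewrite HsignM ?remainder_in // mulrA [X in X * _]mulrC.
Qed.

Lemma expansion_lift phi x : expansion phi (lift x) = phi x.
Proof.
rewrite expansionE /remainder red_lift mulVg /Hsign -signr_odd odd_nzcoord.
by rewrite big1 ?mul1r // => i _; rewrite ecoord1 eqxx.
Qed.

(* Its class modulo K is the argument of [iotaK_inv] in [fz]. *)
Definition carry (x y : G) : E := (lift x * lift y * (lift (x * y))^-1)%g.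

Lemma carry_in x y : carry x y \in H.
Proof. by rewrite mem_Hset !redM redV !red_lift mulgV. Qed.

Lemma fz_sign x y : f x y = Hsign (carry x y).
Proof.
rewrite /fz /tau -morphV ?normK // -!morphM ?normK //.
by rewrite iotaK_invE // carry_in.
Qed.

Lemma lift_mul x y : (lift x * lift y = lift (x * y) * carry x y)%g.
Proof. by rewrite /carry [RHS](E_abel) mulgKV. Qed.

Lemma fz_sym x y : f x y = f y x.
Proof.
rewrite !fz_sign /carry E_abel [(lift y * _)%g]E_abel [RHS](congr1 Hsign (E_abel _ _)).
by congr (Hsign (((lift _)^-1) * _)); apply/ffunP => i; rewrite !cycprodME addrC.
Qed.

Lemma fz_binary (x : G) : binary (f x).
Proof. by move=> y; rewrite fz_sign; apply: binary_sign. Qed.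

Lemma fz_cocycle : normalized_cocycle f.
Proof.
split=> [|| x y w]; first exact: fz_binary.
  rewrite fz_sign /carry mulg1 mulgK.
  have -> : lift 1%g = 1%g.
    by apply/ffunP => i; apply: val_inj; rewrite /= -/(ecoord _ i) ecoord_lift gcoord1 cycprod1E.
  by rewrite /Hsign -signr_odd odd_nzcoord big1 // => i _; rewrite ecoord1 eqxx.
rewrite !fz_sign -!HsignM ?carry_in //; congr Hsign.
(* Both products of carries are what remains in [H] when [lift x * lift y * lift w] is compared with
   [lift (x * y * w)]. *)
apply: (mulgI (lift (x * y * w)%g)); transitivity (lift x * lift y * lift w)%g.
  by rewrite (E_abel (carry x y)) mulgA -lift_mul -mulgA (E_abel (lift w)) mulgA -lift_mul.
by rewrite -(mulgA x y w) (mulgA (lift _) (carry _ _)) -lift_mul -!mulgA -lift_mul.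
Qed.

(** The fibre of the reduction over [x] is the coset of [H] through [lift x]. *)
Lemma big_Egrp (R : Type) (idx : R) (op : Monoid.com_law idx) (F : E -> R) :
  \big[op/idx]_g F g = \big[op/idx]_x \big[op/idx]_(h in H) F (lift x * h)%g.
Proof.
rewrite (partition_big red predT) //=; apply: eq_bigr => x _.
rewrite (reindex_inj (mulgI (lift x))) /=; apply: eq_bigl => h.
by rewrite redM red_lift mem_Hset -{2}(mulg1 x) (inj_eq (mulgI x)).
Qed.

Lemma card_Egrp : #|E| = (#|G| * #|H|)%N.
Proof.
rewrite -[LHS]sum1_card (eq_bigl xpredT) // big_Egrp /= -sum_nat_const.
by apply: eq_bigr => x _; rewrite sum1_card.
Qed.

Lemma card_red_preim (P : pred G) :
  #|[set g : E | P (red g)]| = (#|[set x | P x]| * #|H|)%N.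
Proof.
rewrite -[LHS]sum1dep_card big_mkcond big_Egrp /=.
rewrite -[X in (X * _)%N]sum1dep_card [in RHS]big_mkcond big_distrl; apply: eq_bigr => x _ /=.
under eq_bigr => h hH do rewrite red_mulH // red_lift.
by rewrite sum_nat_const mulnC; case: (P x); rewrite ?muln1 ?mul1n ?muln0.
Qed.

(** * Autocorrelations of the expansion as row sums *)

Definition twisted (phi : G -> int) (x y : G) : int := f x y * cobd phi x y.

(** On a coset of [H] the summand is constant, because [Hsign h] enters twice; each [x] thus
    contributes [#|H|] times one entry of row [red g], up to a sign depending only on [g]. *)
Lemma autocorr_expansion (phi : G -> int) g : binary phi ->
  autocorr (expansion (z := z) phi) g =
  #|H|%:Z * Hsign (remainder g) * (phi (red g) * row_sum (twisted phi) (red g)).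
Proof.
move=> bphi.
have term (x : G) h : h \in H ->
    expansion phi (lift x * h)%g * expansion phi (lift x * h * g)%g
    = Hsign (remainder g) * (phi (red g) * twisted phi (red g) x).
  move=> hH; rewrite (expansionMH _ _ hH) expansion_lift.
  (* Write the shifted argument as a lift times an element of [H], so that [expansionMH] applies. *)
  have -> : (lift x * h * g = lift (x * red g) * (carry x (red g) * (h * remainder g)))%g.
    by rewrite mulgA -lift_mul (E_abel h) -!mulgA (E_abel h) /remainder !mulgA mulgK.
  have rH := remainder_in g; have cH := carry_in x (red g).
  have hrH : (h * remainder g)%g \in H by apply: groupM.
  have kH : (carry x (red g) * (h * remainder g))%g \in H by apply: groupM.
  rewrite (expansionMH _ _ kH) expansion_lift (HsignM cH hrH) (HsignM hH rH).
  rewrite /twisted /cobd fz_sym fz_sign.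
  have -> : (red g * x = x * red g)%g by apply/ffunP => i; rewrite !cycprodME addrC.
  transitivity (Hsign h * Hsign h * Hsign (carry x (red g)) * Hsign (remainder g) *
                (phi x * phi (x * red g)%g)); first by ring.
  rewrite Hsign_sqr.
  (* Inserting phi(red g) squared, which is 1, completes the factor [cobd phi]. *)
  transitivity (phi (red g) * phi (red g) * Hsign (carry x (red g)) *
                Hsign (remainder g) * (phi x * phi (x * red g)%g)); last by ring.
  by rewrite binary_sqr.
rewrite /autocorr big_Egrp /row_sum mulr_sumr mulr_sumr; apply: eq_bigr => x _.
by rewrite (eq_bigr _ (term x)) sumr_const -mulr_natl natz mulrA.
Qed.

(** The sign [e g] is harmless because the allowed values are symmetric under negation. In (ii) both
    cardinalities are [#|H|] times those in [G], and [#|H|] cancels. *)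
Lemma is_GOBA_row_sums (phi : G -> int) : binary phi ->
  is_GOBA z phi <->
  row_values (twisted phi) /\
  (z ord0 -> 2 * #|[set x | row_sum (twisted phi) x == 0%R]| = #|G|)%N.
Proof.
move=> bphi; have H0 : (0 < #|H|)%N by apply/card_gt0P; exists 1%g; exact: group1.
pose e g := Hsign (remainder g) * phi (red g).
have e1 g : e g = 1 \/ e g = -1.
  exact: (binaryM (binary_sign (fun g => nzcoord (remainder g))) (fun g => bphi (red g))).
have RE g : autocorr (expansion (z := z) phi) g
            = #|H|%:Z * (e g * row_sum (twisted phi) (red g)).
  by rewrite autocorr_expansion // /e !mulrA.
have R0 g : (autocorr (expansion (z := z) phi) g == 0)
            = (row_sum (twisted phi) (red g) == 0).
  by rewrite RE 2!mulf_eq0; case: (e1 g) => -> /=; case: #|H| H0.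
have c0 : #|[set g | autocorr (expansion (z := z) phi) g == 0%R]|
          = (#|[set x | row_sum (twisted phi) x == 0%R]| * #|H|)%N.
  by rewrite -card_red_preim; apply: eq_card => g; rewrite !inE R0.
rewrite /is_GOBA /= c0 card_Egrp mulnA.
suff vals : (forall g, g \notin H ->
     [\/ autocorr (expansion (z := z) phi) g = 0,
         autocorr (expansion (z := z) phi) g = (2 * #|H|)%N%:Z
       | autocorr (expansion (z := z) phi) g = - (2 * #|H|)%N%:Z])
   <-> row_values (twisted phi).
  split=> [] [/vals rv c]; split=> // /c /eqP.
    by rewrite eqn_pmul2r // => /eqP.
  by move=> /eqP ->.
split=> [v x x1|rv g].
  have := v (lift x); rewrite mem_Hset red_lift => /(_ x1).
  rewrite RE red_lift; set S := row_sum _ _.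
  case: (e1 (lift x)) => -> h; case: (ltrgtP S 0) => S0;
    by [constructor 1 | constructor 2; case: h; nia | constructor 3; case: h; nia].
rewrite mem_Hset => /rv; rewrite RE.
by case: (e1 g) => -> [] ->; rewrite ?mulr0 ?mul1r ?mulN1r;
  [constructor 1|constructor 2|constructor 3|constructor 1|constructor 3|constructor 2];
  lia.
Qed.

Lemma twisted_cocycle (phi : G -> int) :
  binary phi -> phi 1%g = 1 -> normalized_cocycle (twisted phi).
Proof.
move=> bphi phi1; case: fz_cocycle => bf f11 fc; split=> [x y||x y w].
- apply: (binaryM (bf x)) => {}y.
  by rewrite /cobd; case: (bphi x) => ->; case: (bphi y) => ->; case: (bphi (x * y)%g) => ->; auto.
- by rewrite /twisted f11 /cobd mulg1 phi1.
rewrite /twisted /cobd mulgA.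
(* Beyond the cocycle identity for [f], one only trades the square of phi(xy) for that of phi(yw),
   both equal to 1. *)
transitivity (f x y * f (x * y)%g w * (phi (x * y)%g * phi (x * y)%g) *
              (phi x * phi y * phi w * phi (x * y * w)%g)); first by ring.
rewrite fc binary_sqr // -(binary_sqr (y * w)%g bphi); ring.
Qed.

(* For odd [s], [(x + y) %/ s] has the parity of [x + y + (x + y) %% s]. *)
Lemma twisted_coboundary (phi : G -> int) :
  (forall i, z i -> odd (s i)) -> binary phi -> phi 1%g = 1 ->
  coboundary (twisted phi).
Proof.
move=> os bphi phi1.
pose n (x : G) := (\sum_(i | z i) gcoord x i)%N.
exists (fun x => (-1) ^+ n x * phi x); split.
- exact: binaryM (binary_sign n) bphi.
- by rewrite phi1 mulr1 /n big1 // => i _; rewrite gcoord1.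
move=> x y; rewrite /twisted fzE //.
suff -> : \prod_(i | z i) (-1) ^+ ((gcoord x i + gcoord y i) %/ s i)
          = (-1) ^+ n x * (-1) ^+ n y * (-1) ^+ n (x * y)%g :> int.
  by rewrite /cobd; ring.
rewrite /n !expr_sum -!big_split /=; apply: eq_bigr => i zi.
rewrite gcoordM -!exprD -signr_odd -[RHS]signr_odd.
have e := congr1 odd (divn_eq (gcoord x i + gcoord y i) (s i)).
by rewrite [in RHS]oddD e oddD oddM os // andbT -addbA addbb addbF.
Qed.

End Expansion.

(** * The equivalence, according to the value of z at the even coordinate *)

Lemma card_cycprod (r : nat) (m : 'I_r -> nat) :
  (forall i, (1 < m i)%N) -> #|cycprod m| = (\prod_i m i)%N.
Proof.
move=> m1; rewrite card_dep_ffun.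
rewrite foldrE big_map big_enum /=; apply: eq_bigr => i _.
by rewrite card_ord Zp_cast.
Qed.

Theorem theorem2 (t r : nat) (s : 'I_r.+1 -> nat) (z : 'I_r.+1 -> bool)
  (ht : (1 <= t)%N)
  (hs : forall i, (1 < s i)%N)
  (hprod : (\prod_(i < r.+1) s i = 4 * t + 2)%N)
  (hs1 : (2 %| s ord0)%N /\ odd (s ord0 %/ 2))
  (hodd : forall i, i != ord0 -> odd (s i))
  (hz : exists i, z i)
  (phi : cycprod s -> int)
  (hphi : binary phi)
  (hphi0 : phi 1%g = 1) :
  is_GOBA z phi <->
  quasi_orthogonal t (fun x y : cycprod s => fz z x y * cobd phi x y).
Proof.
have cG : #|cycprod s| = (4 * t + 2)%N by rewrite card_cycprod.
rewrite is_GOBA_row_sums // cG.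
have coc := twisted_cocycle hs hz hphi hphi0.
case: (boolP (z ord0)) => z0; last first.
  have cob : coboundary (twisted z phi).
    apply: twisted_coboundary => // i zi; apply: hodd.
    by apply: contraNneq z0 => <-.
  rewrite (coboundary_quasi_orthogonal cG coc cob).
  by split=> [[]//|]; split.
case: hs1 => /dvdnP[q s0] _.
(* The involution of [G]: half of the even modulus [s ord0] in that coordinate and 0 elsewhere. *)
pose c : cycprod s := [ffun i => if i == ord0 then inZp q else 0 : 'Z_(s i)].
have cE i : gcoord c i = (if i == ord0 then q else 0%N) :> nat.
  rewrite /gcoord ffunE; case: eqP => // -> /=.
  by rewrite modn_small // Zp_cast // s0; have := hs ord0; lia.
have cc1 : (c * c)%g = 1%g.
  apply: gcoord_inj => i; rewrite gcoordM // cE gcoord1.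
  by case: eqP => [->|_]; rewrite ?addn0 ?mod0n // s0 addnn -muln2 modnn.
have psicc : twisted z phi c c = -1.
  rewrite /twisted /cobd cc1 hphi0 mulr1 binary_sqr // mulr1 fzE // (bigD1 ord0) //=.
  (* Doubling [c] carries exactly once, in coordinate [ord0], where q + q = [s ord0]; every other
     factor is 1. *)
  rewrite big1 => [|i /andP[_ /negPf i0]]; last by rewrite !cE i0 div0n.
  rewrite !cE eqxx addnn -muln2 -s0 divnn.
  by rewrite ltnW.
rewrite (involution_quasi_orthogonal cG coc cc1 psicc).
by split=> [] [rv c0]; split=> //; apply: c0.
Qed.
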